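(* Let $s>0$ and let $n \geq 0$ be an integer. Then $$\sum_{j=0}^{n}\sum_{i=0}^{j} (-1)^j \binom{n}{j} \frac{B(j+1,s)}{s+i} = \frac{1}{(s+n)^2}.$$
   Context: $B(x,y)=\int_0^1 t^{x-1}(1-t)^{y-1}\,dt = \frac{\Gamma(x)\Gamma(y)}{\Gamma(x+y)}$ for $x,y>0$ denotes the beta function. *)

(* Defs.v *)
From Stdlib Require Import Reals.
From Coquelicot Require Import Coquelicot.
Open Scope R_scope.

(* The integral over ]0, 1[ is improper at both ends: the integrand blows up
   at 0 when x < 1 and at 1 when y < 1. It converges exactly for x, y > 0;
   outside this range RInt_gen returns an unspecified value. *)
Definition Beta (x y : R) : R :=
  RInt_gen (fun t : R => Rpower t (x - 1) * Rpower (1 - t) (y - 1))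
    (at_right 0) (at_left 1).

(* Main.v *)
Require Import Defs.
From Stdlib Require Import Reals Lra Lia.
From Coquelicot Require Import Coquelicot.
Open Scope R_scope.

(** Write [b_j(s) = B(j+1, s)] and [H_j(s) = 1/s + ... + 1/(s+j)].  Integration
    by parts gives [b_(j+1)(s) = (j+1)/(s+j+1) b_j(s)], hence
    [b_j(s) = j! / (s (s+1) ... (s+j))].  The product [g_j(s) = b_j(s) H_j(s)]
    (which is [- b_j'(s)]) satisfies [g_j(s) - g_(j+1)(s) = g_j(s+1)], so by
    Pascal's rule the alternating binomial sum of order [n+1] at [s] is the one
    of order [n] at [s+1]; iterating down to order [0] leaves
    [g_0(s+n) = 1/(s+n)^2]. *)

(** On each compact [[x, y]] inside []a, b[] the integral is [F y - F x], so the improper integral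
    needs only the one-sided limits of [F]; [f] may blow up at both ends. *)
Lemma is_RInt_gen_derive_open (F f : R -> R) (a b la lb : R) :
  a < b ->
  (forall t, a < t < b -> is_derive F t (f t)) ->
  (forall t, a < t < b -> continuous f t) ->
  filterlim F (at_right a) (locally la) ->
  filterlim F (at_left b) (locally lb) ->
  is_RInt_gen f (at_right a) (at_left b) (lb - la).
Proof.
intros Hab HF Hf Ha Hb P HP.
assert (Hlim : filterlim (fun p : R * R => F (snd p) - F (fst p))
          (filter_prod (at_right a) (at_left b)) (locally (lb - la))).
{ apply (filterlim_comp_2 (G := locally lb) (H := locally (- la))
           (fun p : R * R => F (snd p)) (fun p : R * R => - F (fst p))
           Rplus).
  - exact (filterlim_comp _ _ _ _ _ _ _ _ filterlim_snd Hb).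
  - apply (filterlim_comp _ _ _ (fun p : R * R => F (fst p)) Ropp _ (locally la)).
    + exact (filterlim_comp _ _ _ _ _ _ _ _ filterlim_fst Ha).
    + exact (filterlim_opp la).
  - exact (filterlim_plus lb (- la)). }
assert (Hin : filter_prod (at_right a) (at_left b)
          (fun p => a < fst p < b /\ a < snd p < b)).
{ apply Filter_prod with (fun x => a < x < b) (fun y => a < y < b).
  - assert (h : 0 < b - a) by lra.
    exists (mkposreal _ h); intros y Hy Hy'.
    apply Rabs_def2 in Hy; unfold minus, plus, opp in Hy; simpl in Hy; lra.
  - assert (h : 0 < b - a) by lra.
    exists (mkposreal _ h); intros y Hy Hy'.
    apply Rabs_def2 in Hy; unfold minus, plus, opp in Hy; simpl in Hy; lra.
  - intros x y Hx Hy; simpl; tauto. }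
unfold filtermapi.
generalize (filter_and (fun p : R * R => P (F (snd p) - F (fst p))) _
              (Hlim P HP) Hin).
apply filter_imp; intros [x y] [HPxy [Hx Hy]]; simpl in *.
exists (F y - F x); split; [|exact HPxy].
assert (Hbetween : forall t, Rmin x y <= t <= Rmax x y -> a < t < b).
{ intros t; unfold Rmin, Rmax; destruct (Rle_dec x y); lra. }
apply (is_RInt_derive F f x y); intros t Ht; auto.
Qed.

Lemma filterlim_Rpower_0 (s : R) :
  0 < s -> filterlim (fun y => Rpower y s) (at_right 0) (locally 0).
Proof.
intros Hs; apply filterlim_locally; intros eps.
(* The radius solves [y^s = eps]; [y^s] is increasing in [y] because [s > 0]. *)
exists (mkposreal (Rpower eps (/ s)) (exp_pos _)); intros y Hy Hy0.
apply Rabs_def2 in Hy; unfold minus, plus, opp in Hy; simpl in Hy.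
apply Rabs_def1; unfold minus, plus, opp; simpl.
- replace (pos eps) with (Rpower (Rpower eps (/ s)) s).
  + assert (h : Rpower y s < Rpower (Rpower eps (/ s)) s)
      by (apply Rlt_Rpower_l; lra).
    lra.
  + rewrite Rpower_mult, Rinv_l, Rpower_1; [easy|apply cond_pos|lra].
- assert (h : 0 < Rpower y s) by apply exp_pos.
  destruct eps as [e He]; simpl; lra.
Qed.

Lemma filterlim_Rpower_1_minus (s : R) :
  0 < s -> filterlim (fun t => Rpower (1 - t) s) (at_left 1) (locally 0).
Proof.
intros Hs.
apply (filterlim_comp _ _ _ (fun t => 1 - t) (fun y => Rpower y s) _ (at_right 0)).
2: now apply filterlim_Rpower_0.
intros P [d Hd]; exists d; intros y Hy Hy1.
apply Hd; [|lra].
apply Rabs_def2 in Hy; unfold minus, plus, opp in Hy; simpl in Hy.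
apply Rabs_def1; unfold minus, plus, opp; simpl; lra.
Qed.

Fixpoint beta_closed (s : R) (j : nat) : R :=
  match j with
  | O => / s
  | S k => (INR k + 1) / (s + INR k + 1) * beta_closed s k
  end.

(* An antiderivative of [t^j (1-t)^(s-1)], from
   [(t^(k+1) (1-t)^s)' = (k+1) t^k (1-t)^(s-1) - (s+k+1) t^(k+1) (1-t)^(s-1)]. *)
Fixpoint beta_primitive (s : R) (j : nat) (t : R) : R :=
  match j with
  | O => - / s * Rpower (1 - t) s
  | S k => / (s + INR k + 1) *
      ((INR k + 1) * beta_primitive s k t - t ^ S k * Rpower (1 - t) s)
  end.

Lemma is_derive_beta_primitive (s : R) (j : nat) (t : R) :
  0 < s -> t < 1 ->
  is_derive (beta_primitive s j) t (t ^ j * Rpower (1 - t) (s - 1)).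
Proof.
intros Hs Ht.
assert (HR : is_derive (fun t => Rpower (1 - t) s) t
               (- s * Rpower (1 - t) (s - 1))).
{ unfold Rpower; auto_derive; [lra|].
  replace ((s - 1) * ln (1 - t)) with (s * ln (1 + - t) + - ln (1 - t))
    by (unfold Rminus; ring).
  rewrite exp_plus, exp_Ropp, exp_ln by lra.
  field; lra. }
induction j as [|k IH].
- simpl.
  evar_last; [apply is_derive_scal; exact HR|simpl; field; lra].
- pose proof (pos_INR k) as Hk.
  assert (Hpow : is_derive (fun t => t ^ S k) t ((INR k + 1) * t ^ k)).
  { evar_last; [apply is_derive_pow, is_derive_id|].
    rewrite S_INR; unfold one; simpl; ring. }
  evar_last.
  + change (beta_primitive s (S k)) with
      (fun t => / (s + INR k + 1) *
        ((INR k + 1) * beta_primitive s k t - t ^ S k * Rpower (1 - t) s)).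
    apply is_derive_scal.
    apply @is_derive_minus; [apply is_derive_scal, IH|].
    apply @is_derive_mult; [exact Hpow|exact HR|intros; apply Rmult_comm].
  + unfold minus, plus, opp, mult; simpl.
    (* With a single power of [1 - t] left, the claim is a rational identity. *)
    replace (Rpower (1 - t) s) with (Rpower (1 - t) (s - 1) * (1 - t)).
    * field; lra.
    * rewrite <- (Rpower_1 (1 - t)) at 2 by lra.
      rewrite <- Rpower_plus; f_equal; ring.
Qed.

(** The term [t^(k+1) (1-t)^s] vanishes at 0, which leaves the recursion of [beta_closed] with the
    opposite initial value. *)
Lemma beta_primitive_0 (s : R) (j : nat) :
  0 < s -> beta_primitive s j 0 = - beta_closed s j.
Proof.
intros Hs; induction j as [|k IH]; simpl.
- unfold Rpower; rewrite Rminus_0_r, ln_1, Rmult_0_r, exp_0; ring.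
- pose proof (pos_INR k); rewrite IH; field; lra.
Qed.

(** Every term carries the factor [(1-t)^s], which tends to 0, so the upper end contributes nothing
    to the integral. *)
Lemma filterlim_beta_primitive_1 (s : R) (j : nat) :
  0 < s -> filterlim (beta_primitive s j) (at_left 1) (locally 0).
Proof.
intros Hs.
pose proof (filterlim_Rpower_1_minus s Hs) as HR.
assert (Hscal : forall (c : R) (f : R -> R),
  filterlim f (at_left 1) (locally 0) ->
  filterlim (fun t => c * f t) (at_left 1) (locally 0)).
{ intros c f Hf; rewrite <- (Rmult_0_r c).
  apply (filterlim_comp _ _ _ f (Rmult c) _ (locally 0)); [exact Hf|].
  exact (filterlim_scal_r c (0 : R)). }
induction j as [|k IH]; [now apply Hscal|].
simpl beta_primitive; apply Hscal.
replace 0 with (0 + - (1 ^ S k * 0)) by ring.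
apply (filterlim_comp_2 (G := locally 0) (H := locally (- (1 ^ S k * 0)))
         (fun t => (INR k + 1) * beta_primitive s k t)
         (fun t => - (t ^ S k * Rpower (1 - t) s)) Rplus).
- now apply Hscal.
- apply (filterlim_comp _ _ _ (fun t => t ^ S k * Rpower (1 - t) s) Ropp _
           (locally (1 ^ S k * 0))); [|exact (filterlim_opp (1 ^ S k * 0 : R))].
  apply (filterlim_comp_2 (G := locally (1 ^ S k)) (H := locally 0)
           (fun t => t ^ S k) (fun t => Rpower (1 - t) s) Rmult).
  + apply (filterlim_filter_le_1 (F := locally 1)); [apply filter_le_within|].
    apply (ex_derive_continuous (fun t : R => t ^ S k)); now auto_derive.
  + exact HR.
  + exact (filterlim_mult (1 ^ S k : R) (0 : R)).
- exact (filterlim_plus (0 : R) (- (1 ^ S k * 0))).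
Qed.

Lemma Beta_closed (s : R) (j : nat) :
  0 < s -> Beta (INR j + 1) s = beta_closed s j.
Proof.
intros Hs; apply is_RInt_gen_unique.
apply (is_RInt_gen_ext (fun t => t ^ j * Rpower (1 - t) (s - 1))).
(* [Rpower_pow] needs a positive base; endpoints that are both positive keep [t] positive between
   them. *)
{ apply Filter_prod with (fun x => 0 < x) (fun y => 0 < y).
  - exists (mkposreal 1 Rlt_0_1); intros y _ Hy; exact Hy.
  - exists (mkposreal 1 Rlt_0_1); intros y Hy _.
    apply Rabs_def2 in Hy; unfold minus, plus, opp in Hy; simpl in Hy; lra.
  - intros x y Hx Hy t; simpl; intros [Ht _].
    replace (INR j + 1 - 1) with (INR j) by ring.
    rewrite Rpower_pow; [easy|].
    revert Ht; unfold Rmin; destruct (Rle_dec x y); lra. }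
replace (beta_closed s j) with (0 - beta_primitive s j 0)
  by (rewrite beta_primitive_0; [ring|assumption]).
apply is_RInt_gen_derive_open with (beta_primitive s j).
- lra.
- intros t Ht; apply is_derive_beta_primitive; lra.
- intros t Ht; apply (ex_derive_continuous
    (fun t : R => t ^ j * Rpower (1 - t) (s - 1))).
  unfold Rpower; auto_derive; lra.
- apply (filterlim_filter_le_1 (F := locally 0)); [apply filter_le_within|].
  apply (ex_derive_continuous (beta_primitive s j)).
  eexists; apply is_derive_beta_primitive; lra.
- now apply filterlim_beta_primitive_1.
Qed.

(** In the denominator [s (s+1) ... (s+j)] the shift drops the factor [s] and gains [s+j+1]. *)
Lemma beta_closed_shift (s : R) (j : nat) :
  0 < s -> beta_closed (s + 1) j = s / (s + INR j + 1) * beta_closed s j.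
Proof.
intros Hs; induction j as [|k IH].
- simpl; field; lra.
- change (beta_closed (s + 1) (S k)) with
    ((INR k + 1) / (s + 1 + INR k + 1) * beta_closed (s + 1) k).
  change (beta_closed s (S k)) with
    ((INR k + 1) / (s + INR k + 1) * beta_closed s k).
  rewrite IH, S_INR; pose proof (pos_INR k); field; lra.
Qed.

Lemma sum_inv_shift (s : R) (j : nat) :
  0 < s ->
  sum_f_R0 (fun i => / (s + 1 + INR i)) j
  = sum_f_R0 (fun i => / (s + INR i)) j - / s + / (s + INR j + 1).
Proof.
intros Hs; induction j as [|k IH].
- simpl; rewrite !Rplus_0_r; ring.
- rewrite !tech5, IH, S_INR.
  replace (s + 1 + (INR k + 1)) with (s + (INR k + 1) + 1) by ring.
  replace (s + INR k + 1) with (s + (INR k + 1)) by ring.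
  ring.
Qed.

Definition beta_harmonic (s : R) (j : nat) : R :=
  beta_closed s j * sum_f_R0 (fun i => / (s + INR i)) j.

(** Under the integral, [t^j - t^(j+1) = t^j (1-t)] gives [b_j(s) - b_(j+1)(s) = b_j(s+1)], and this
    is its derivative in [s] up to sign. Algebraically, both sides equal [b_j(s) (s H_j(s) / (s+j+1)
    - (j+1) / (s+j+1)^2)]. *)
Lemma beta_harmonic_shift (s : R) (j : nat) :
  0 < s ->
  beta_harmonic s j - beta_harmonic s (S j) = beta_harmonic (s + 1) j.
Proof.
intros Hs; unfold beta_harmonic.
rewrite beta_closed_shift, sum_inv_shift, tech5, S_INR by assumption.
change (beta_closed s (S j)) with
  ((INR j + 1) / (s + INR j + 1) * beta_closed s j).
pose proof (pos_INR j); field; lra.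
Qed.

Definition alternating_binomial_sum (f : nat -> R) (n : nat) : R :=
  sum_f_R0 (fun j => (-1) ^ j * Binomial.C n j * f j) n.

Lemma alternating_binomial_sum_S (f : nat -> R) (n : nat) :
  alternating_binomial_sum f (S n)
  = alternating_binomial_sum (fun j => f j - f (S j)) n.
Proof.
(* Pascal's rule on the partial sums leaves one boundary term. *)
assert (Hpart : forall m, (m < n)%nat ->
  sum_f_R0 (fun j => (-1) ^ j * Binomial.C (S n) j * f j) (S m)
  = sum_f_R0 (fun j => (-1) ^ j * Binomial.C n j * (f j - f (S j))) m
    + (-1) ^ S m * Binomial.C n (S m) * f (S m)).
{ induction m as [|m IH]; intros Hm.
  - simpl sum_f_R0; rewrite <- (pascal n 0) by lia; rewrite !C_n_0; simpl; ring.
  - rewrite tech5, IH by lia; rewrite tech5, <- (pascal n (S m)) by lia.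
    simpl pow; ring. }
unfold alternating_binomial_sum; destruct n as [|m].
- simpl sum_f_R0; rewrite !C_n_0, C_n_n; simpl; ring.
(* Here [n] is [S m]. The top index is split off because [Binomial.C n (S n)] is not 0 (truncated
   subtraction makes it [1/(n+1)]), so Pascal's rule fails there. The top term and the boundary term
   together form the last difference [(-1)^n (f n - f (S n))]. *)
- rewrite tech5, Hpart by lia.
  rewrite tech5, !C_n_n; simpl pow; ring.
Qed.

Lemma alternating_binomial_sum_ext (f g : nat -> R) (n : nat) :
  (forall j, f j = g j) ->
  alternating_binomial_sum f n = alternating_binomial_sum g n.
Proof.
intros H; apply sum_eq; intros j _; now rewrite H.
Qed.

Lemma alternating_sum_beta_harmonic (n : nat) (s : R) :
  0 < s -> alternating_binomial_sum (beta_harmonic s) n = 1 / (s + INR n) ^ 2.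
Proof.
revert s; induction n as [|n IH]; intros s Hs.
- unfold alternating_binomial_sum, beta_harmonic; simpl.
  rewrite C_n_0; field; lra.
- rewrite alternating_binomial_sum_S.
  rewrite (alternating_binomial_sum_ext _ (beta_harmonic (s + 1)))
    by (intros j; now apply beta_harmonic_shift).
  rewrite IH, S_INR by lra.
  do 2 f_equal; ring.
Qed.

Theorem theorem2p3 (s : R) (n : nat) (hs : 0 < s) :
  sum_f_R0 (fun j : nat =>
    sum_f_R0 (fun i : nat =>
      (-1) ^ j * Binomial.C n j * (Beta (INR j + 1) s / (s + INR i))) j) n
  = 1 / (s + INR n) ^ 2.
Proof.
rewrite <- alternating_sum_beta_harmonic by assumption.
apply sum_eq; intros j _; unfold beta_harmonic.
(* The factor independent of [i] moves into the harmonic sum, to match the double sum termwise. *)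
rewrite Beta_closed, <- Rmult_assoc, scal_sum by assumption.
apply sum_eq; intros i _; unfold Rdiv; ring.
Qed.
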